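(* For integers $n\ge2$ and $0\le t\le n-2$, the number of $(102,201)$-avoiding inversion sequences $e$ of length $n$ with $\mathrm{rank}(e)=t$ is $$\sum_{m=1}^{n-t-1}a(n,t,m)+\sum_{m=1}^{n-t-3}b(n,t,m),$$ where $$a(n,t,m)=\frac{t+1}{m+t+1}\binom{2m+t}{m}\binom{n-t-2}{m-1}$$ and $$b(n,t,m)=(t+1)\big(2^{n-m-t-2}-1\big)+\sum_{j=1}^{m-1}\sum_{s=0}^{t}\sum_{k=0}^{n-m-t-3}(2^{k+1}-1)\cdot\frac{m+s-j+1}{m+s+1}\binom{m+j+s}{j}\binom{n+j-m-t-k-4}{j-1}.$$ (Sums whose upper limit is less than their lower limit are $0$.)
   Context: An inversion sequence of length $n$ is an integer sequence $e=(e_1,\dots,e_n)$ with $0\le e_j\le j-1$ for all $j$. It contains a pattern $w=w_1w_2w_3$ if there are indices $i_1<i_2<i_3$ such that $e_{i_1}e_{i_2}e_{i_3}$ is order-isomorphic to $w$ (same relations $<,=,>$ between corresponding pairs of entries); otherwise it avoids $w$. ''$(w,w')$-avoiding'' means avoiding both $w$ and $w'$. $\max(e)$ is the largest entry, and $\mathrm{fdes}(e)$ is the position $p$ of the first descent: $e_1\le\cdots\le e_p>e_{p+1}$, with the convention $e_{n+1}=-1$. For a $102$-avoiding $e$, $\mathrm{rank}(e):=\mathrm{fdes}(e)-\max(e)-1$. *)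

(* Defs.v *)
From mathcomp Require Import all_boot all_order all_algebra.

Set Implicit Arguments.
Unset Strict Implicit.
Unset Printing Implicit Defensive.

Import Order.TTheory GRing.Theory Num.Theory.

Local Open Scope nat_scope.

(* Positions are 0-based, so e_j <= j-1 reads e_j <= j. *)
Definition inversion_seq (e : seq nat) : bool :=
  all (fun j => nth 0 e j <= j) (iota 0 (size e)).

Definition order_iso (u v : seq nat) : bool :=
  (size u == size v) &&
  [forall i : 'I_(size u), forall j : 'I_(size u),
     ((nth 0 u i < nth 0 u j) == (nth 0 v i < nth 0 v j)) &&
     ((nth 0 u i == nth 0 u j) == (nth 0 v i == nth 0 v j))].

Definition contains (w e : seq nat) : bool :=
  [exists i1 : 'I_(size e), exists i2 : 'I_(size e), exists i3 : 'I_(size e),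
     [&& i1 < i2, i2 < i3 &
         order_iso [:: nth 0 e i1; nth 0 e i2; nth 0 e i3] w]].

Definition avoids (w e : seq nat) : bool := ~~ contains w e.

Definition max_entry (e : seq nat) : nat := \max_(x <- e) x.

(* 1-based position of the first descent; the default value -1 of nth
   implements the convention e_{n+1} = -1. *)
Definition fdes (e : seq nat) : nat :=
  let e' := [seq Posz x | x <- e] in
  (find (fun p => (nth (-1) e' p.+1 < nth (-1) e' p)%R) (iota 0 (size e))).+1.

Definition rank (e : seq nat) : int :=
  (Posz (fdes e) - Posz (max_entry e) - 1)%R.

(* Entries of an inversion sequence of length n are smaller than n, so these
   sequences all live in the finite type of n-tuples over 'I_n. *)
Definition inv_102_201_rank (n t : nat) : {set n.-tuple 'I_n} :=
  [set e : n.-tuple 'I_n |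
    let s := [seq val x | x <- e] in
    [&& inversion_seq s, avoids [:: 1; 0; 2] s, avoids [:: 2; 0; 1] s
      & rank s == Posz t]].

Local Open Scope ring_scope.

(* The subtractions below that are taken in nat are never truncated for
   t <= n-2 and m, j, s, k within the ranges of summation. *)
Definition a (n t m : nat) : rat :=
  (t + 1)%:R / (m + t + 1)%:R * 'C(2 * m + t, m)%:R * 'C(n - t - 2, m - 1)%:R.

Definition b (n t m : nat) : rat :=
  (t + 1)%:R * (2 ^+ (n - m - t - 2) - 1) +
  \sum_(1 <= j < m) \sum_(0 <= s < t.+1) \sum_(0 <= k < n - m - t - 2)
    (2 ^+ (k + 1) - 1) * ((m + s - j + 1)%:R / (m + s + 1)%:R)
    * 'C(m + j + s, j)%:R * 'C(n + j - m - t - k - 4, j - 1)%:R.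

(* Main.v *)
(* An avoider weakly increases up to its first descent, at position
   [m + t + 1], where it takes its maximal value [m].  If [m] does not occur
   later, the rest weakly decreases below [m]: these sequences are counted by
   [a].  Otherwise, let [x < m] be the entry after the first descent: no entry
   lies strictly between [x] and [m], and the rest is a word over [{x, m}]
   containing [m], followed by a weakly decreasing word below [x]: these are
   counted by [b], with [j = x], [m + s] entries before the first [m], and
   [k + 2] letters in the word over [{x, m}]. *)
Require Import Defs.
From mathcomp Require Import all_boot all_order all_algebra.
From mathcomp Require Import zify ring.

Set Implicit Arguments.
Unset Strict Implicit.
Unset Printing Implicit Defensive.

Local Open Scope nat_scope.

(** * Sums over words of fixed length *)

(** Plain lists replace tuples here so that a sum over them can be split at the first letter, at the
    last letter or at any cut. *)
Fixpoint words N n : seq (seq nat) :=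
  if n is n'.+1 then [seq x :: w | x <- iota 0 N, w <- words N n'] else [:: [::]].

Lemma mem_words N n s :
  (s \in words N n) = (size s == n) && all (fun x => x < N) s.
Proof.
elim: n s => [|n IHn] [|x s] //=.
  by apply/negbTE/negP => /allpairsP [[y w] [_ _]].
rewrite eqSS; apply/allpairsP/andP => [[[y w] /= [yN wn [-> ->]]]|[sn /andP[xN sN]]].
  by move: yN wn; rewrite mem_iota IHn /= => -> /andP[-> ->].
by exists (x, s); rewrite mem_iota IHn sn sN.
Qed.

Lemma words_uniq N n : uniq (words N n).
Proof.
elim: n => //= n IHn; apply: allpairs_uniq => //; first exact: iota_uniq.
by move=> [x s] [y w] _ _ /= [-> ->].
Qed.

Lemma card_tuples_words N n (P : pred (seq nat)) :
  #|[set e : n.-tuple 'I_N | P [seq val x | x <- e]]|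
    = \sum_(w <- words N n) P w.
Proof.
rewrite -sum1_card big_mkcond /=.
transitivity (\sum_(w <- [seq [seq val x | x <- val e] | e <- enum {: n.-tuple 'I_N}]) P w).
  rewrite big_map big_enum /=; apply: eq_bigr => e _.
  by rewrite inE; case: (P _).
apply: perm_big; apply: uniq_perm; last first.
- move=> s; rewrite mem_words; apply/mapP/andP => [[e _ ->]|[/eqP sn sN]].
    rewrite size_map size_tuple; split=> //.
    by apply/allP => _ /mapP [x _ ->]; apply: ltn_ord.
  (* The preimage of [s] is obtained by retyping each letter in ['I_N]; no letter is lost, since all
     are below [N]. *)
  have sE : [seq val x | x <- pmap (insub : nat -> option 'I_N) s] = s.
    rewrite pmap_filter; last exact: insubK.
    apply/all_filterP; apply: sub_all sN => x.
    by rewrite /= isSome_insub.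
  have szE : size (pmap (insub : nat -> option 'I_N) s) == n.
    by rewrite -(size_map val) sE sn.
  by exists (Tuple szE); rewrite ?mem_enum.
- exact: words_uniq.
rewrite map_inj_uniq ?enum_uniq // => e f /inj_map ef.
by apply/val_inj/ef/val_inj.
Qed.

Lemma big_words_cons N n (F : seq nat -> nat) :
  \sum_(w <- words N n.+1) F w
    = \sum_(x < N) \sum_(w <- words N n) F (nat_of_ord x :: w).
Proof.
by rewrite /= big_allpairs_dep -[N in iota 0 N]subn0 -/(index_iota 0 N) big_mkord.
Qed.

Lemma big_words_cat N p q (F : seq nat -> nat) :
  \sum_(w <- words N (p + q)) F w
    = \sum_(u <- words N p) \sum_(v <- words N q) F (u ++ v).
Proof.
elim: p F => [|p IHp] F; first by rewrite big_seq1.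
rewrite addSn !big_words_cons; apply: eq_bigr => x _.
exact: (IHp (fun w => F (nat_of_ord x :: w))).
Qed.

Lemma big_words_rcons N n (F : seq nat -> nat) :
  \sum_(w <- words N n.+1) F w
    = \sum_(x < N) \sum_(w <- words N n) F (rcons w (nat_of_ord x)).
Proof.
rewrite -addn1 big_words_cat exchange_big big_words_cons.
apply: eq_bigr => x _; rewrite big_seq1.
by apply: eq_bigr => w _; rewrite cats1.
Qed.

Lemma sum_ord_eq N y c : y < N -> \sum_(x < N) (x == y :> nat) * c = c.
Proof.
move=> yN; rewrite (bigD1 (Ordinal yN)) //= eqxx mul1n [X in _ + X]big1 ?addn0 // => x.
by rewrite -val_eqE /= => /negbTE ->.
Qed.

(** * Counting the possible suffixes *)

Definition wdec j (v : seq nat) := sorted geq v && all (fun x => x < j) v.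

(** The first letter is the largest, so it becomes the new inclusive bound, whence [x.+1]. *)
Lemma wdec_cons j x v : wdec j (x :: v) = (x < j) && wdec x.+1 v.
Proof.
rewrite /wdec /= (path_sortedE (rev_trans leq_trans)).
apply/andP/andP => [[/andP[vx sv] /andP[xj vj]]|[xj /andP[sv vx]]].
  by split=> //; rewrite sv.
rewrite xj; split; first by rewrite sv andbT.
by apply: sub_all vx => y /= yx; apply: leq_trans xj.
Qed.

(** The number of multisets of size [q] on [j] letters, ['C(q + j - 1, q)]; the match on [q] avoids
    the subtraction. *)
Definition ndec q j := if q is q'.+1 then 'C(q' + j, q) else 1.

Lemma ndecS q j : ndec q.+1 j = \sum_(x < j) ndec q x.+1.
Proof.
elim: j => [|j IHj]; first by rewrite big_ord0 /= bin_small // addn0.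
rewrite big_ord_recr /= -IHj; case: q {IHj} => [|q] /=; first by rewrite !bin1 addn1.
by rewrite addnS binS addSnnS.
Qed.

Lemma sum_wdec N q j : j <= N -> \sum_(v <- words N q) wdec j v = ndec q j.
Proof.
elim: q j => [|q IHq] j jN; first by rewrite big_seq1.
rewrite big_words_cons ndecS (big_ord_widen _ (fun x => ndec q x.+1) jN).
rewrite [RHS]big_mkcond /=; apply: eq_bigr => x _.
rewrite (eq_bigr (fun w => (x < j) * wdec x.+1 w)); last first.
  by move=> w _; rewrite wdec_cons mulnb.
by rewrite -big_distrr /= IHq; case: (x < j); rewrite ?mul1n.
Qed.

Fixpoint mixed x m (w : seq nat) :=
  if w is y :: w' then
    if (y == x) || (y == m) then mixed x m w' else wdec x w
  else true.

(** Here [k] is the length of the maximal prefix over [{x, m}], with two choices per letter; what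
    follows is weakly decreasing below [x]. The term [k = 0] collects the words that are [wdec x]
    from the start. *)
Lemma sum_mixed N x m r : x < m -> m < N ->
  \sum_(w <- words N r) mixed x m w = \sum_(k < r.+1) 2 ^ k * ndec (r - k) x.
Proof.
move=> xm mN; have xN := ltn_trans xm mN.
elim: r => [|r IHr]; first by rewrite big_seq1 big_ord1.
rewrite big_ord_recl expn0 mul1n subn0 -(sum_wdec r.+1 (ltnW xN)).
transitivity (\sum_(y < N) ((y == x :> nat) + (y == m :> nat)) *
                 (\sum_(w <- words N r) mixed x m w)
      + \sum_(w <- words N r.+1) wdec x w).
  rewrite !big_words_cons -big_split /=; apply: eq_bigr => y _.
  have [->|yx] := eqVneq (y : nat) x.
    by rewrite (ltn_eqF xm) mul1n [X in _ + X]big1 ?addn0 // => w _; rewrite wdec_cons ltnn.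
  have [->|ym] := eqVneq (y : nat) m.
    rewrite mul1n [X in _ + X]big1 ?addn0 // => w _.
    by rewrite wdec_cons ltnNge (ltnW xm).
  by rewrite mul0n.
rewrite addnC; congr (_ + _).
rewrite -big_distrl big_split /=.
have E y : y < N -> \sum_(i < N) (i == y :> nat) = 1.
  move=> yN; rewrite -[RHS](sum_ord_eq 1 yN).
  by apply: eq_bigr => i _; rewrite muln1.
rewrite !E // IHr big_distrr; apply: eq_bigr => k _.
by rewrite /= mulnA -expnS /bump add1n subSS.
Qed.

(** The letter [m] can only occur in the prefix over [{x, m}], so exactly the prefix made of [x]
    alone is excluded. In the induction, a first letter [m] leaves an arbitrary mixed word, and
    [(2 ^ k - 1) + 2 ^ k = 2 ^ k.+1 - 1]. *)
Lemma sum_mixed_mem N x m r : x < m -> m < N ->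
  \sum_(w <- words N r) (mixed x m w && (m \in w))
    = \sum_(k < r.+1) (2 ^ k - 1) * ndec (r - k) x.
Proof.
move=> xm mN; have xN := ltn_trans xm mN.
elim: r => [|r IHr]; first by rewrite big_seq1 big_ord1.
rewrite big_ord_recl /= mul0n add0n.
transitivity (\sum_(y < N) ((y == x :> nat) *
                 (\sum_(w <- words N r) (mixed x m w && (m \in w))) +
      (y == m :> nat) * \sum_(w <- words N r) mixed x m w)).
  rewrite !big_words_cons; apply: eq_bigr => y _ /=.
  have [->|yx] := eqVneq (y : nat) x.
    rewrite (ltn_eqF xm) mul1n addn0; apply: eq_bigr => w _.
    by rewrite inE gtn_eqF.
  have [->|ym] := eqVneq (y : nat) m.
    by rewrite mul1n; apply: eq_bigr => w _; rewrite inE eqxx andbT.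
  rewrite big1 // => w _; rewrite wdec_cons /wdec inE eq_sym (negbTE ym) /=.
  have [yx'|//] := ltnP y x; case: (sorted _ _) => //=.
  case: (boolP (m \in w)); rewrite ?andbF // => mw.
  by case: allP => // /(_ _ mw); rewrite ltnS leqNgt (ltn_trans yx' xm).
rewrite big_split /= !sum_ord_eq // IHr sum_mixed // -big_split.
apply: eq_bigr => k _; rewrite /bump /= add1n subSS -mulnDl expnS.
by congr (_ * _); have := expn_gt0 2 k; lia.
Qed.

(** * Weakly increasing prefixes and ballot numbers *)

Definition winc j u :=
  [&& sorted leq u, inversion_seq u & all (fun x => x <= j) u].

Lemma inversion_seq_nth e :
  reflect (forall i, i < size e -> nth 0 e i <= i) (inversion_seq e).
Proof.
apply: (iffP allP) => [H i ie|H i]; first by apply: H; rewrite mem_iota.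
by rewrite mem_iota; apply: H.
Qed.

Lemma inversion_seq_rcons u x :
  inversion_seq (rcons u x) = inversion_seq u && (x <= size u).
Proof.
apply/inversion_seq_nth/andP => [H|[/inversion_seq_nth H xu] i].
  split; last by have := H (size u); rewrite nth_rcons ltnn eqxx size_rcons; exact.
  apply/inversion_seq_nth => i iu; have := H i.
  by rewrite nth_rcons iu size_rcons; apply; rewrite ltnW.
rewrite size_rcons ltnS leq_eqVlt nth_rcons => /orP[/eqP ->|iu].
  by rewrite ltnn eqxx.
by rewrite iu H.
Qed.

Lemma sorted_rcons_leq (u : seq nat) x :
  sorted leq (rcons u x) = sorted leq u && all (fun y => y <= x) u.
Proof.
rewrite -(revK (rcons u x)) rev_rcons rev_sorted /=.
by rewrite (path_sortedE (rev_trans leq_trans)) andbC -rev_sorted revK all_rev.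
Qed.

Lemma winc_rcons j u x :
  winc j (rcons u x) = [&& x <= j, x <= size u & winc x u].
Proof.
rewrite /winc sorted_rcons_leq inversion_seq_rcons all_rcons.
case: (leqP x j) => //= [xj|]; last by rewrite !andbF.
have [ux|] := boolP (all _ u); last by rewrite !andbF.
have -> : all (fun y => y <= j) u by apply: sub_all ux => y /leq_trans; apply.
by rewrite !andbT; case: (_ <= size u); rewrite ?andbF ?andbT.
Qed.

Lemma sum_wincS N L j : L < N ->
  \sum_(u <- words N L.+1) winc j u
    = \sum_(x < L.+1 | x <= j) \sum_(u <- words N L) winc x u.
Proof.
move=> LN; rewrite big_words_rcons.
rewrite (big_ord_widen_cond _ (fun x => x <= j)
           (fun x => \sum_(u <- words N L) winc x u) LN) [RHS]big_mkcond /=.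
apply: eq_bigr => x _; rewrite ltnS.
rewrite (eq_big_seq (fun u => ((x <= j) && (x <= L)) * winc x u)); last first.
  move=> u; rewrite mem_words => /andP[/eqP su _].
  by rewrite winc_rcons su andbA mulnb.
by rewrite -big_distrr /=; case: andP; rewrite ?mul1n.
Qed.

(* The ballot recursion, in a form without subtraction. *)
Lemma sum_winc N L j : L <= N -> j <= L ->
  \sum_(u <- words N L) winc j u + (if j is i.+1 then 'C(L + j, i) else 0)
    = 'C(L + j, j).
Proof.
elim: L j => [|L IHL] j LN jL.
  by move: jL; rewrite leqn0 => /eqP ->; rewrite big_seq1.
pose I x := \sum_(u <- words N L) winc x u.
(* Partial sums of the ballot numbers of length [L] are ballot numbers of length [L.+1], by Pascal's
   rule. *)
have S i : i <= L ->
    \sum_(x < i.+1) I x + (if i is i'.+1 then 'C(L.+1 + i, i') else 0)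
      = 'C(L.+1 + i, i).
  elim: i => [|i IHi] iL; first by rewrite big_ord1 /I -[LHS]/(_ + _) IHL ?bin0 // ltnW.
  rewrite big_ord_recr /=; have := IHi (ltnW iL); have := IHL _ (ltnW LN) iL.
  case: i {IHi} iL => [|i] iL; rewrite -/(I _) !addSn !addnS ?addn0.
    by rewrite !bin0 !bin1 => -[->] ->.
  rewrite (binS (L + i).+2 i.+1) (binS (L + i).+2 i).
  by move: (I _) (\sum_(_ < _) _) => p q; lia.
rewrite sum_wincS //; have [jL'|Lj] := leqP j L.
  rewrite -(S _ jL'); congr (_ + _).
  by rewrite (big_ord_widen_cond L.+1 xpredT I).
(* On the boundary the bound [j] is vacuous, as the last entry is at most [L]: the count is that of
   [j = L], and symmetry of the binomials of [(L + L).+1] reconciles the formulas. *)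
have -> : j = L.+1 by apply/eqP; rewrite eqn_leq jL.
rewrite (eq_bigl xpredT) => [|x]; last by rewrite ltnW.
have := S _ (leqnn L); rewrite /I; move: (\sum_(_ < _) _) => p.
have E : 'C((L + L).+1, L.+1) = 'C((L + L).+1, L).
  by rewrite -bin_sub ?ltnS ?leq_addr // subSS addnK.
rewrite !addSn !addnS (binS (L + L).+1) E.
case: L {IHL LN jL S Lj I E} => [|L] /=; first by rewrite !bin0; lia.
by rewrite !addSn !addnS (binS (L + L).+3 L); lia.
Qed.

(* The possible parts of [e] up to the first descent, when [max_entry e = m]. *)
Definition upto m u := [&& sorted leq u, inversion_seq u & last 0 u == m].

Definition gap x m := [pred y | (y <= x) || (y == m)].

Lemma upto_rcons m u y :
  upto m (rcons u y) = [&& y == m, m <= size u & winc m u].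
Proof.
rewrite /upto last_rcons sorted_rcons_leq inversion_seq_rcons /winc.
have [->|] := eqVneq y m; rewrite ?andbF //= andbT.
by case: (sorted _ _); case: (inversion_seq _); case: (all _ _); rewrite ?andbF ?andbT.
Qed.

(** The last entry is forced to be [m], which index [m + t] permits; removing it leaves any weakly
    increasing prefix bounded by [m]. *)
Lemma sum_upto N m t : m < N ->
  \sum_(u <- words N (m + t).+1) upto m u = \sum_(u <- words N (m + t)) winc m u.
Proof.
move=> mN; rewrite big_words_rcons -[RHS](sum_ord_eq _ mN).
apply: eq_bigr => y _; rewrite big_distrr /=.
apply: eq_big_seq => u; rewrite mem_words => /andP[/eqP su _].
by rewrite upto_rcons su leq_addr mulnb.
Qed.

Lemma winc_gap x m u : x < m ->
  winc m u && all (gap x m) u = winc x u + (upto m u && all (gap x m) u) :> nat.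
Proof.
move=> xm; case/lastP: u => [|u y].
  (* The empty word has [last 0] equal to [0], which differs from [m] because [x < m]. *)
  by case: m xm.
rewrite !winc_rcons upto_rcons !all_rcons /=.
have [->|ym] := eqVneq y m.
  by rewrite leqnn (leqNgt m x) xm.
rewrite orbF /= addn0; have [yx|] := leqP y x; last by rewrite !andbF.
rewrite (leq_trans yx (ltnW xm)) /=; case: (y <= size u) => //=.
case: (boolP (winc y u)) => //= /and3P[_ _ uy].
by rewrite (sub_all _ uy) // => z /= zy; rewrite (leq_trans zy yx).
Qed.

(** Peeling off the final copies of [m] leaves a word bounded by [x]; [m + s] is its length. It is
    at least [m] because [m] cannot occur at an earlier index. *)
Lemma sum_upto_gap N x m t : x < m -> m < N ->
  \sum_(u <- words N (m + t).+1) (upto m u && all (gap x m) u)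
    = \sum_(s < t.+1) \sum_(u <- words N (m + s)) winc x u.
Proof.
move=> xm mN.
have W L : \sum_(u <- words N L.+1) (upto m u && all (gap x m) u)
    = (m <= L) * (\sum_(u <- words N L) winc x u
        + \sum_(u <- words N L) (upto m u && all (gap x m) u)).
  rewrite big_words_rcons -[RHS](sum_ord_eq _ mN).
  apply: eq_bigr => y _; rewrite -big_split !big_distrr /=.
  apply: eq_big_seq => u; rewrite mem_words => /andP[/eqP su _].
  rewrite -winc_gap // upto_rcons all_rcons su /= !mulnb.
  by have [->|] := eqVneq (nat_of_ord y) m; rewrite //= orbT -andbA.
elim: t => [|t IHt].
  rewrite addn0 W leqnn mul1n big_ord1 addn0.
  (* A word whose length is the maximum cannot end in that maximum, so nothing more can be peeled
     off. *)
  by case: m xm mN W => // m xm mN W; rewrite [X in _ + X]W ltnn addn0.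
by rewrite big_ord_recr -IHt W leq_addr mul1n addnC [in X in X + _]addnS.
Qed.

(** * Pattern avoidance as flatness of valleys *)

(* Avoidance of 102 and 201: entries before and after a smaller entry [b],
   both larger than [b], are equal. *)
Definition flat a b c := (b < a) && (b < c) ==> (a == c).

Fixpoint valley_flat (s : seq nat) :=
  if s is a :: s' then pairwise (flat a) s' && valley_flat s' else true.

Lemma valley_flatP s :
  reflect (forall i j k, i < j -> j < k -> k < size s ->
             flat (nth 0 s i) (nth 0 s j) (nth 0 s k))
          (valley_flat s).
Proof.
elim: s => [|a s IHs] /=; first by left.
apply: (iffP andP) => [[/(pairwiseP 0) H /IHs K] [|i] [|j] [|k] //= ij jk ks|H].
- exact: H (ltn_trans jk ks) ks jk.
- exact: K.
split.
  apply/(pairwiseP 0) => j k; rewrite !inE => js ks jk.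
  exact: (H 0 j.+1 k.+1).
by apply/IHs => i j k ij jk ks; apply: (H i.+1 j.+1 k.+1).
Qed.

Lemma order_iso102 x y z :
  order_iso [:: x; y; z] [:: 1; 0; 2] = (y < x) && (x < z).
Proof.
apply/andP/andP => [[_ /forallP H]|[yx xz]].
  have /forallP /(_ (Ordinal (isT : 0 < 3))) := H (Ordinal (isT : 1 < 3)).
  have /forallP /(_ (Ordinal (isT : 2 < 3))) := H (Ordinal (isT : 0 < 3)).
  by move=> /andP[/eqP /= -> _] /andP[/eqP /= -> _].
split=> //; apply/forallP => -[[|[|[|i]]] ?] //; apply/forallP => -[[|[|[|j]]] ?] //=;
  apply/andP; split; apply/eqP; rewrite ?ltnn ?eqxx //=; lia.
Qed.

Lemma order_iso201 x y z :
  order_iso [:: x; y; z] [:: 2; 0; 1] = (y < z) && (z < x).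
Proof.
apply/andP/andP => [[_ /forallP H]|[yz zx]].
  have /forallP /(_ (Ordinal (isT : 2 < 3))) := H (Ordinal (isT : 1 < 3)).
  have /forallP /(_ (Ordinal (isT : 0 < 3))) := H (Ordinal (isT : 2 < 3)).
  by move=> /andP[/eqP /= -> _] /andP[/eqP /= -> _].
split=> //; apply/forallP => -[[|[|[|i]]] ?] //; apply/forallP => -[[|[|[|j]]] ?] //=;
  apply/andP; split; apply/eqP; rewrite ?ltnn ?eqxx //=; lia.
Qed.

Lemma avoidsP w s :
  reflect (forall i j k, i < j -> j < k -> k < size s ->
             ~~ order_iso [:: nth 0 s i; nth 0 s j; nth 0 s k] w)
          (avoids w s).
Proof.
apply: (iffP idP) => [/existsP H i j k ij jk ks|H].
  apply/negP => ww; apply: H.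
  exists (Ordinal (ltn_trans ij (ltn_trans jk ks))).
  apply/existsP; exists (Ordinal (ltn_trans jk ks)).
  by apply/existsP; exists (Ordinal ks); rewrite /= ij jk.
apply/existsP => -[i /existsP[j /existsP[k /and3P[ij jk]]]].
exact/negP/H.
Qed.

Lemma avoids_valley_flat s :
  avoids [:: 1; 0; 2] s && avoids [:: 2; 0; 1] s = valley_flat s.
Proof.
apply/andP/valley_flatP => [[/avoidsP H /avoidsP K] i j k ij jk ks|H].
  have := H i j k ij jk ks; have := K i j k ij jk ks.
  by rewrite order_iso102 order_iso201 /flat; lia.
split; apply/avoidsP => i j k ij jk ks; have := H i j k ij jk ks;
  by rewrite ?order_iso102 ?order_iso201 /flat; lia.
Qed.

(** A triple whose first two entries lie in the increasing part [u] has no valley, so only triples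
    with at least two entries in [v] matter. *)
Lemma valley_flat_cat u v : sorted leq u ->
  valley_flat (u ++ v) = all (fun a => pairwise (flat a) v) u && valley_flat v.
Proof.
elim: u => //= a u IHu au; rewrite IHu ?(path_sorted au) //.
rewrite pairwise_cat -!andbA.
have ua : all (leq a) u by apply: order_path_min au; apply: leq_trans.
have -> : allrel (flat a) u v.
  apply/allrelP => b c /(allP ua) ab _.
  by rewrite /flat ltnNge ab.
have -> // : pairwise (flat a) u.
  apply/(pairwiseP 0) => i j iu _ _.
  by rewrite /flat ltnNge (all_nthP 0 ua).
Qed.

Lemma sorted_geq_flat a v : sorted geq v -> pairwise (flat a) v.
Proof.
rewrite (sorted_pairwise (rev_trans leq_trans)).
apply: sub_pairwise => b c /= cb.
by rewrite /flat [b < c]ltnNge cb andbF.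
Qed.

Lemma sorted_geq_valley_flat v : sorted geq v -> valley_flat v.
Proof.
elim: v => //= a v IHv av; rewrite sorted_geq_flat ?(path_sorted av) //.
exact/IHv/(path_sorted av).
Qed.

Lemma mixed_gap x m w : mixed x m w -> all (gap x m) w.
Proof.
elim: w => //= y w IHw; case: ifP => [yxm /IHw ->|_].
  by rewrite andbT; case/orP: yxm => /eqP ->; rewrite ?leqnn ?eqxx ?orbT.
by case/andP=> _; apply: (@sub_all _ _ (gap x m) _ (y :: w)) => z /= /ltnW ->.
Qed.

(** Above a middle entry [x], only [m] is available on either side; above [m] nothing is; and a
    middle entry in the decreasing tail is followed by nothing larger. *)
Lemma mixed_flat x m a w : x < m -> gap x m a -> mixed x m w -> pairwise (flat a) w.
Proof.
move=> xm xma; elim: w => [|y w IHw] //= yw; apply/andP; split.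
  apply/allP => c cw; move: yw xma; rewrite /flat /=.
  case: eqP => [->|_] /=; last case: eqP => [->|_] /=.
  - by move=> /mixed_gap/allP/(_ c cw) /=; lia.
  - lia.
  move=> /andP[/(order_path_min (rev_trans leq_trans))/allP/(_ c cw) /=]; lia.
move: yw; case: ifP => [_ /IHw //|_ /andP[/path_sorted yw _]].
exact: sorted_geq_flat.
Qed.

Lemma mixed_valley_flat x m w : x < m -> mixed x m w -> valley_flat w.
Proof.
move=> xm; elim: w => //= y w IHw.
case: ifP => [yxm yw|_ /andP[yw _]]; last exact: (@sorted_geq_valley_flat (y :: w)).
rewrite IHw // (mixed_flat xm _ yw) //=.
by case/orP: yxm => /eqP ->; rewrite ?leqnn ?eqxx ?orbT.
Qed.

(** Once a letter [y < x] appears, a later [c > y] would have to equal both [m] and [x]. So all that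
    follows is at most [y], and flatness against [m] then forbids any rise. *)
Lemma flat_mixed x m w : x < m -> all (gap x m) w ->
  pairwise (flat m) w -> pairwise (flat x) w -> mixed x m w.
Proof.
move=> xm; elim: w => //= y w IHw /andP[xy xw] /andP[ym wm] /andP[yx wx].
case: ifP => [_|yxm]; first exact: IHw.
have {yxm}xy : y < x by lia.
have yw : all (geq y) w.
  apply/allP => c cw; move/allP/(_ c cw): ym; move/allP/(_ c cw): yx.
  by rewrite /flat /=; lia.
rewrite /wdec /= xy (path_sortedE (rev_trans leq_trans)) yw.
rewrite (sorted_pairwise (rev_trans leq_trans)) /=; apply/andP; split.
  apply/(pairwiseP 0) => i j iw jw ij /=.
  have := pairwiseP 0 wm i j iw jw ij; rewrite /flat.
  have := all_nthP 0 yw i iw; have := all_nthP 0 yw j jw => /=; lia.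
by apply: sub_all yw => z /=; lia.
Qed.

(** * Splitting an avoider at its first descent *)

Definition mixed_tail x m v :=
  if v is y :: w then [&& y == x, mixed x m w & m \in w] else false.

Lemma fdes_cat u v : 0 < size u ->
  (fdes (u ++ v) == size u)
    = sorted leq u && (if v is z :: _ then z < last 0 u else true).
Proof.
(* Writing the prefix as [rcons u y] makes [size u] the 0-based index at which [find] has to
   stop. *)
case/lastP: u => [|u y] // _; rewrite last_rcons size_rcons /fdes eqSS.
set e := map _ _; set P := fun p => _.
have -> : iota 0 (size (rcons u y ++ v)) = iota 0 (size u) ++ size u :: iota (size u).+1 (size v).
  by rewrite size_cat size_rcons addSnnS iotaD.
rewrite find_cat /= size_iota.
have E i : i < size (rcons u y ++ v) -> nth (-1)%R e i = nth 0 (rcons u y ++ v) i.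
  by move=> ie; rewrite (nth_map 0).
(* For empty [v] the default [-1] is read after [y], which always counts as a descent. *)
have -> : P (size u) = (if v is z :: _ then z < y else true).
  rewrite /P [X in (_ < X)%R]E ?size_cat ?size_rcons ?leq_addr //.
  rewrite nth_cat size_rcons ltnSn nth_rcons ltnn eqxx.
  case: v @e P E => [|z v] e P E.
    by rewrite nth_default // /e size_map cats0 size_rcons.
  by rewrite E ?size_cat ?size_rcons /= ?addnS ?ltnS ?leq_addr // nth_cat size_rcons ltnn subnn.
have hasE : has P (iota 0 (size u)) = ~~ sorted leq (rcons u y).
  apply/hasP/idP => [[i]|].
    rewrite mem_iota /= => iu; rewrite /P !E ?size_cat ?size_rcons; try lia.
    rewrite !nth_cat size_rcons; have -> : i < (size u).+1 by lia.
    rewrite ltnS iu => Pi; apply/negP => /(sortedP 0)/(_ i).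
    by rewrite size_rcons ltnS iu => /(_ isT); move: Pi; lia.
  move=> /(sortedP 0) S; apply/hasP; apply: contra_notT S => /hasPn H i.
  rewrite size_rcons ltnS => iu; have := H i; rewrite mem_iota iu => /(_ isT).
  rewrite /P !E ?size_cat ?size_rcons; try lia.
  rewrite !nth_cat size_rcons; have -> : i < (size u).+1 by lia.
  by rewrite ltnS iu; lia.
rewrite hasE; case: (boolP (sorted _ _)) hasE => [_ _|_ hP].
  by case: (match v with [::] => _ | _ => _ end); rewrite /= ?addn0 ?eqxx //; lia.
by rewrite has_find size_iota in hP; rewrite ltn_eqF.
Qed.

(** The default [-1] after the last entry makes the last index a descent, so [find] succeeds. *)
Lemma fdes_le s : s != [::] -> fdes s <= size s.
Proof.
case/lastP: s => // s x _; rewrite /fdes size_rcons ltnS.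
set P := fun p => _; have : has P (iota 0 (size s).+1).
  apply/hasP; exists (size s); first by rewrite mem_iota ltnSn.
  rewrite /P nth_default ?size_map ?size_rcons //.
  by rewrite (nth_map 0) ?size_rcons.
by rewrite has_find size_iota ltnS.
Qed.

Lemma max_entry_eq s m :
  m \in s -> all (fun x => x <= m) s -> max_entry s = m.
Proof.
move=> ms /allP sm; apply/eqP; rewrite eqn_leq /max_entry leq_bigmax_seq // andbT.
by apply/bigmax_leqP_seq => x xs _; apply: sm.
Qed.

(** Entries of [v] sit at indices beyond [m], so their bound is automatic. *)
Lemma inversion_seq_cat u v m : m < size u -> all (fun x => x <= m) v ->
  inversion_seq (u ++ v) = inversion_seq u.
Proof.
move=> mu vm; apply/inversion_seq_nth/inversion_seq_nth => H i iu.
  by have := H i; rewrite nth_cat iu size_cat; apply; rewrite ltn_addr.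
rewrite nth_cat; case: ltnP => [/H //|ui].
have := all_nthP 0 vm (i - size u); move: iu; rewrite size_cat => iu H'.
by have := H' ltac:(lia); lia.
Qed.

(* After the first descent, the entries smaller than [m] weakly decrease, and
   a later [m] forces those before it to equal some [x] such that no entry lies
   strictly between [x] and [m]. *)
Lemma valley_flat_upto u v m : m \in u -> all (fun x => x <= m) u -> sorted leq u ->
  (valley_flat (u ++ v) && (if v is z :: _ then z < m else true))
    = (wdec m v || (if v is x :: _ then
         [&& x < m, all (gap x m) u & mixed_tail x m v] else false)).
Proof.
move=> mu um su; rewrite valley_flat_cat //.
case: v => [|x w]; first by rewrite /= !andbT; apply/allP.
have [xm|mx] := ltnP x m; last by rewrite andbF wdec_cons ltnNge mx.
rewrite andbT /= eqxx /=; apply/andP/orP => [[/allP uw /andP[xw fw]]|].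
  have /= /andP[/allP xc mw] := uw m mu.
  have [mIw|mNw] := boolP (m \in w); last first.
    left; rewrite wdec_cons xm /wdec /=.
    have cx c : c \in w -> c <= x.
      move=> cw; have := xc c cw; rewrite /flat xm /=.
      by case: eqP mNw => [->|]; [rewrite cw|rewrite implybF -leqNgt].
    rewrite (sorted_pairwise (rev_trans leq_trans)); apply/andP; split.
      apply/(pairwiseP 0) => i j iw jw ij.
      have := pairwiseP 0 mw i j iw jw ij; rewrite /flat.
      have := cx _ (mem_nth 0 iw); have := cx _ (mem_nth 0 jw) => /=; lia.
    by apply/allP => c /cx.
  right; rewrite andbT; apply/andP; split.
    apply/allP => a au /=; have /= /andP[/allP/(_ m mIw)] := uw a au.
    by rewrite /flat xm andbT; lia.
  apply: flat_mixed => //; apply/allP => c /xc; rewrite /flat /=; lia.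
case=> [/andP[xw _]|/and3P[gu xw mIw]].
  split; last exact: (@sorted_geq_valley_flat (x :: w)).
  by apply/allP => a _; apply: (@sorted_geq_flat a (x :: w)).
have xxw : mixed x m (x :: w) by rewrite /= eqxx.
split; last exact: (mixed_valley_flat xm xxw).
by apply/allP => a au; apply: (mixed_flat xm _ xxw); apply: (allP gu).
Qed.

(** The entry after the first descent is a valley, so by flatness any later entry above it equals
    [last 0 u]. Hence [last 0 u] is the maximum, and the inversion condition only concerns [u]. *)
Lemma first_descent_split u v m : m < size u ->
  [&& inversion_seq (u ++ v), valley_flat (u ++ v), fdes (u ++ v) == size u
    & max_entry (u ++ v) == m]
  = upto m u && (wdec m v || (if v is x :: _ then
         [&& x < m, all (gap x m) u & mixed_tail x m v] else false)).
Proof.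
move=> mu; have u0 : 0 < size u by lia.
have lu : last 0 u \in u by case: u u0 {mu} => //= a u _; apply: mem_last.
rewrite fdes_cat // /upto; case: (boolP (sorted leq u)) => su; rewrite ?andbF //=.
have uM : all (fun x => x <= last 0 u) u.
  case/lastP: u su {mu u0 lu} => // u y.
  by rewrite sorted_rcons_leq all_rcons last_rcons leqnn => /andP[].
case: (eqVneq (last 0 u) m) => [lm|lm]; last first.
  rewrite andbF; apply/negbTE; apply: contra lm => /and4P[_ fuv hv /eqP <-].
  rewrite eq_sym; apply/eqP/max_entry_eq; first by rewrite mem_cat lu.
  rewrite all_cat uM; move: fuv; rewrite valley_flat_cat // => /andP[/allP/(_ _ lu) + _].
  case: v hv => //= x w xl /andP[/allP xw _]; rewrite ltnW //=.
  by apply/allP => c /xw; rewrite /flat xl /=; lia.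
rewrite lm in lu uM *; rewrite andbT -valley_flat_upto //.
case: (boolP (valley_flat _)) => fuv; rewrite ?andbF //=.
case: (boolP (match v with [::] => _ | _ => _ end)) => hv; rewrite ?andbF //=.
have vm : all (fun x => x <= m) v.
  move: fuv; rewrite valley_flat_cat // => /andP[/allP/(_ _ lu) + _].
  case: v hv => //= x w xl /andP[/allP xw _]; rewrite ltnW //=.
  by apply/allP => c /xw; rewrite /flat xl /=; lia.
rewrite (inversion_seq_cat mu vm) (@max_entry_eq _ m) ?eqxx //.
  by rewrite mem_cat lu.
by rewrite all_cat uM.
Qed.

(** Rank [t] means that [fdes s] is [(max_entry s + t).+1], so at most the summand [m = max_entry s]
    is nonzero; the work is to show that this [m] lies in the range. *)
Lemma rank_split n t s : size s = n -> t.+1 < n ->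
  [&& inversion_seq s, avoids [:: 1; 0; 2] s, avoids [:: 2; 0; 1] s
    & rank s == Posz t]
  = \sum_(1 <= m < n - t) [&& inversion_seq s, valley_flat s,
      fdes s == (m + t).+1 & max_entry s == m] :> nat.
Proof.
move=> sn tn; rewrite (andbA (avoids _ _)) avoids_valley_flat.
have -> : (rank s == Posz t) = (fdes s == (max_entry s + t).+1).
  by rewrite /rank; lia.
case: (inversion_seq s); last by rewrite big1.
case: (valley_flat s); last by rewrite big1.
rewrite /=; have [fd|fd] := boolP (fdes s == _); last first.
  rewrite big1 // => m _; have [sm|] := eqVneq (max_entry s) m; last by rewrite andbF.
  by rewrite -sm (negbTE fd).
have max_lt : max_entry s < n - t.
  have := fdes_le (_ : s != [::]); rewrite -size_eq0 sn (eqP fd); lia.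
(* With maximum [0] the first descent would be at [t.+1 < n], requiring an entry below [0]. *)
have max_gt0 : 0 < max_entry s.
  rewrite lt0n; apply/negP => /eqP s0.
  have szt : size (take t.+1 s) = t.+1 by rewrite size_takel // sn ltnW.
  have := @fdes_cat (take t.+1 s) (drop t.+1 s).
  rewrite cat_take_drop szt; move: fd; rewrite s0 add0n => -> /(_ isT).
  move=> /esym/andP[_].
  have : size (drop t.+1 s) != 0 by rewrite size_drop sn; lia.
  case: (drop _ _) => // z v _; suff -> : last 0 (take t.+1 s) = 0 by [].
  apply/eqP; rewrite -leqn0 -{2}s0.
  case E: (take t.+1 s) => [|a u] //=.
  apply: leq_bigmax_seq => //; apply: (mem_take (n0 := t.+1)).
  by rewrite E mem_last.
rewrite (bigD1_seq (max_entry s)) ?iota_uniq ?mem_index_iota ?max_gt0 //=.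
rewrite fd eqxx big1 // => m ms.
by rewrite [_ == m]eq_sym (negbTE ms) andbF.
Qed.

(** * Summing over prefixes, suffixes and the maximum *)

Lemma sum_mixed_tail N x m q : x < m -> m < N ->
  \sum_(v <- words N q) mixed_tail x m v
    = \sum_(k < q) (2 ^ k - 1) * ndec (q.-1 - k) x.
Proof.
move=> xm mN; case: q => [|r]; first by rewrite big_seq1 big_ord0.
rewrite big_words_cons -(sum_mixed_mem r xm mN) -[RHS](sum_ord_eq _ (ltn_trans xm mN)).
apply: eq_bigr => y _; rewrite big_distrr; apply: eq_bigr => w _ /=.
by rewrite mulnb.
Qed.

Lemma sum_first_descent N m t q : 0 < m -> m < N ->
  \sum_(s <- words N ((m + t).+1 + q)) [&& inversion_seq s, valley_flat s,
      fdes s == (m + t).+1 & max_entry s == m]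
  = (\sum_(u <- words N (m + t)) winc m u) * ndec q m
    + \sum_(x < m) (\sum_(s < t.+1) \sum_(u <- words N (m + s)) winc x u)
        * (\sum_(k < q) (2 ^ k - 1) * ndec (q.-1 - k) x).
Proof.
move=> m0 mN; rewrite big_words_cat -sum_upto // -(sum_wdec q (ltnW mN)).
transitivity (\sum_(u <- words N (m + t).+1) \sum_(v <- words N q)
   (upto m u * wdec m v
    + \sum_(x < m) (upto m u && all (gap x m) u) * mixed_tail x m v)).
  apply: eq_big_seq => u; rewrite mem_words => /andP[/eqP su _].
  apply: eq_bigr => v _; rewrite -[(m + t).+1]su first_descent_split; last first.
    by rewrite su ltnS leq_addr.
  case: (upto m u) => /=; last by rewrite big1.
  case: v => [|x w]; first by rewrite big1 // => x _; rewrite muln0.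
  rewrite mul1n wdec_cons.
  have [xm|mx] := ltnP x m => /=; last first.
    rewrite big1 // => y _.
    by rewrite -[_ == _]negbK neq_ltn (leq_trans (ltn_ord y) mx) orbT muln0.
  (* Only the value of [x] equal to the first letter of the suffix contributes. *)
  rewrite (bigD1 (Ordinal xm)) //= big1 => [|y]; last first.
    by rewrite -val_eqE /= eq_sym => /negbTE ->; rewrite muln0.
  rewrite eqxx addn0 mulnb /=; have [xw|] := boolP (wdec _ _); last by [].
  (* The two kinds of suffix exclude each other: a weakly decreasing one stays below [m], a mixed
     one contains [m] again. *)
  suff -> : m \in w = false by rewrite !andbF.
  apply/negbTE/negP; case/andP: xw => _ /allP xw /xw.
  by rewrite ltnS leqNgt xm.
rewrite big_distrlr; under eq_bigr do rewrite big_split.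
rewrite big_split; congr (_ + _).
under eq_bigr do rewrite exchange_big.
rewrite exchange_big; apply: eq_bigr => x _.
by rewrite -sum_upto_gap // -(sum_mixed_tail q (ltn_ord x) mN) big_distrlr.
Qed.

Lemma card_inv_102_201_rank n t : t.+1 < n ->
  #|inv_102_201_rank n t| = \sum_(1 <= m < n - t)
    ((\sum_(u <- words n (m + t)) winc m u) * ndec (n - m - t - 1) m
    + \sum_(x < m) (\sum_(s < t.+1) \sum_(u <- words n (m + s)) winc x u)
        * (\sum_(k < n - m - t - 1) (2 ^ k - 1) * ndec ((n - m - t - 1).-1 - k) x)).
Proof.
move=> tn; pose P s := [&& inversion_seq s, avoids [:: 1; 0; 2] s,
  avoids [:: 2; 0; 1] s & rank s == Posz t].
transitivity (\sum_(s <- words n n) P s); first exact: card_tuples_words.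
under eq_big_seq => s.
  rewrite mem_words => /andP[/eqP sn _].
  rewrite /P (rank_split sn tn); over.
rewrite exchange_big; apply: eq_big_nat => m /andP[m0 mn].
have nE : n = (m + t).+1 + (n - m - t - 1) by lia.
by rewrite {2}nE sum_first_descent //; lia.
Qed.

(** * Closed forms over the rationals *)

Import GRing.Theory Num.Theory.
Local Open Scope ring_scope.

Lemma sum_winc_ballot N L j : (L <= N)%N -> (j <= L)%N ->
  (\sum_(u <- words N L) winc j u)%:R
    = (L - j + 1)%:R / (L + 1)%:R * 'C(L + j, j)%:R :> rat.
Proof.
move=> LN jL; have := sum_winc LN jL; move: (\sum_(u <- _) _)%N => p pE.
have L0 : (L + 1)%:R != 0 :> rat by rewrite pnatr_eq0 addn1.
apply: (mulfI L0); rewrite mulrA mulrCA divff // mulr1 -!natrM; congr _%:R.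
case: j jL pE => [|i] iL pE.
  by rewrite addn0 in pE; rewrite pE !bin0 subn0 !muln1.
(* This turns the difference of adjacent binomials into the ballot quotient: [(L + 1) * 'C(L + j, j
   - 1) = j * 'C(L + j, j)] for [j = i.+1]. *)
have := mul_bin_left (L + i.+1) i; have -> : (L + i.+1 - i = L + 1)%N by lia.
by rewrite -pE; nia.
Qed.

Lemma ndec0 q : ndec q 0 = (q == 0)%N.
Proof. by case: q => // q; rewrite /= addn0 bin_small. Qed.

Lemma ndecE q j : ndec q j.+1 = 'C(q + j, j).
Proof.
case: q => [|q] /=; first by rewrite binn.
by rewrite addnS -addSn -bin_sub ?leq_addr // addKn.
Qed.

Lemma natr_pow2_sub1 k : (2 ^ k - 1)%N%:R = 2 ^+ k - 1 :> rat.
Proof. by rewrite natrB ?expn_gt0 // natrX. Qed.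

Theorem corollary5p13 (n t : nat) (hn : (2 <= n)%N) (ht : (t <= n - 2)%N) :
  #|inv_102_201_rank n t|%:R =
    \sum_(1 <= m < n - t) a n t m + \sum_(1 <= m < n - t - 2) b n t m :> rat.
Proof.
have tn : (t.+1 < n)%N by lia.
have -> : \sum_(1 <= m < n - t - 2) b n t m
  = \sum_(1 <= m < n - t) (if (m < n - t - 2)%N then b n t m else 0).
  rewrite -big_mkcond /= (big_nat_widen _ _ (n - t)); last by lia.
  by apply: eq_bigl.
rewrite (card_inv_102_201_rank tn) natr_sum -big_split /=.
apply: eq_big_nat => m /andP[m0 mn]; rewrite natrD natrM; congr (_ + _).
  rewrite sum_winc_ballot ?leq_addr //; last by lia.
  case: m m0 mn => // m _ mn; rewrite ndecE /a.
  congr (_%:R / _%:R * _%:R * _%:R); try lia.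
  - by congr 'C(_, _); lia.
  - by congr 'C(_, _); lia.
(* For the largest values of [m] the suffix has at most one letter, too short for [x] followed by
   [m]; hence the shorter range of the sum of [b]. *)
rewrite natr_sum; case: ifP => mnt; last first.
  rewrite big1 // => x _; rewrite natrM.
  have [->|->] : (n - m - t - 1 = 0 \/ n - m - t - 1 = 1)%N by lia.
    by rewrite big_ord0 mulr0.
  by rewrite big_ord1 mulr0.
rewrite /b; have [q qE] : exists q, (n - m - t - 2 = q)%N by exists (n - m - t - 2)%N.
have -> : (n - m - t - 1 = q.+1)%N by lia.
rewrite qE; case: m m0 mn mnt qE => // m _ mn mnt qE.
(* The value [x = 0] gives the isolated first summand of [b]; the values [x = j >= 1] give the
   triple sum. *)
rewrite big_ord_recl big_add1 big_mkord; congr (_ + _).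
  rewrite natrM; congr (_ * _).
    rewrite natr_sum (eq_bigr (fun=> 1)) => [|s _].
      by rewrite sumr_const card_ord addn1.
    rewrite sum_winc_ballot //; last by have := ltn_ord s; lia.
    by rewrite subn0 addn0 bin0 mulr1 divff // pnatr_eq0 addn1.
  (* Nothing lies below [x = 0], so the word over [{0, m}] fills the whole suffix and only the last
     [k] survives. *)
  rewrite big_ord_recr /= subnn muln1 big1 ?add0n ?natr_pow2_sub1 // => k _.
  by rewrite ndec0 subn_eq0 leqNgt ltn_ord muln0.
apply: eq_bigr => j _; rewrite natrM !natr_sum big_mkord mulr_suml.
(* The term [k = 0] vanishes since an empty word cannot contain [m]; shifting [k] produces the
   factor [2 ^+ (k + 1) - 1]. *)
apply: eq_bigr => s _; rewrite big_ord_recl subnn mul0n add0r big_mkord mulr_sumr.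
have := ltn_ord s; have := ltn_ord j => jm st.
apply: eq_bigr => k _; have := ltn_ord k => kq.
rewrite natrM natr_pow2_sub1 lift0 ndecE sum_winc_ballot; try lia.
have -> : (q.+1.-1 - bump 0 k + j = n + j.+1 - m.+1 - t - k - 4)%N.
  by rewrite /bump; lia.
by rewrite lift0 (addn1 k) subn1 /= [(m.+1 + j.+1 + s)%N]addnAC; ring.
Qed.
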